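(* Let $S=(s_i)$ be a good orientable sequence of order $n$ with odd weight and period $m$. If $T\in D^{-1}(S)$, then $\mathcal{E}(T)$ is a good orientable sequence of order $n+1$ with odd weight, and its period is $2m$ if $m$ is odd and $2m+1$ if $m$ is even.
   Context: A periodic binary sequence $S=(s_i)$ has period $m$ = least $m>0$ with $s_{i+m}=s_i$ for all $i$; its generating cycle $[s_0,\dots,s_{m-1}]$ determines it. $\mathbf{s}_k(i)=(s_i,\dots,s_{i+k-1})$; $0^k$, $1^k$ denote the tuples of $k$ zeros/ones. The weight is $w(S)=\sum_{i=0}^{m-1}s_i$. The reverse of $(u_0,\dots,u_{n-1})$ is $(u_{n-1},\dots,u_0)$, written $\mathbf{u}^R$. An orientable sequence of order $n$ is a periodic binary sequence of period $m$ such that $\mathbf{s}_n(i)=\mathbf{s}_n(j)$ implies $i\equiv j\pmod m$ and $\mathbf{s}_n(i)\ne\mathbf{s}_n(j)^R$ for all $i,j$. An orientable sequence of order $n$ is good if $0^{n-4}$ occurs exactly once in a period. The Lempel map: $D((t_i))=(t_i\oplus t_{i+1})$ ($\oplus$ = addition mod 2); $D^{-1}(S)$ is the set of periodic binary sequences $T$ with $D(T)=S$. The extension map $\mathcal{E}$, applied to an orientable sequence $U$ of order $k$ and period $p$ containing exactly one occurrence of $1^{k-4}$ per period: if $w(U)$ is odd, $\mathcal{E}(U)=U$; if $w(U)$ is even, write its generating cycle as $[u_0,\dots,u_{p-1}]$ with $u_r=\dots=u_{r+k-5}=1$ (the unique run) and let $\mathcal{E}(U)$ have generating cycle $[u_0,\dots,u_{r-1},1,u_r,\dots,u_{p-1}]$,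 i.e. $1^{k-4}$ is replaced by $1^{k-3}$. *)

(* Defs.v *)
From mathcomp Require Import all_boot.
From mathcomp Require Import boolp classical_sets.

Set Implicit Arguments.
Unset Strict Implicit.
Unset Printing Implicit Defensive.

Definition binseq := nat -> bool.

Definition repeats (s : binseq) (m : nat) : Prop := forall i, s (i + m) = s i.

Definition is_period (s : binseq) (m : nat) : Prop :=
  [/\ 0 < m, repeats s m & forall q, 0 < q -> repeats s q -> m <= q].

Definition periodic (s : binseq) : Prop := exists m, is_period s m.

(* The least period of a periodic sequence; the junk value for a sequence that
   is not periodic is 0. *)
Definition period (s : binseq) : nat := xget 0 [set m | is_period s m]%classic.

Definition generating_cycle (s : binseq) : seq bool := mkseq s (period s).

Definition weight (s : binseq) : nat := \sum_(i < period s) s i.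

(* s_k(i) = (s_i, ..., s_{i+k-1}) *)
Definition window (s : binseq) (k i : nat) : seq bool :=
  mkseq (fun j => s (i + j)) k.

Definition orientable (n : nat) (s : binseq) : Prop :=
  [/\ periodic s,
      forall i j, window s n i = window s n j -> i = j %[mod period s]
    & forall i j, window s n i <> rev (window s n j)].

(* Occurrences are counted cyclically: an occurrence may start at any position
   of the generating cycle and run past its end. *)
Definition occurs_once (v : seq bool) (s : binseq) : Prop :=
  #|[set i : 'I_(period s) | window s (size v) i == v]| = 1.

(* The truncated subtraction is harmless: for n <= 4 the empty word would have
   to occur once per period, so s would have period 1, hence be constant and
   not orientable. *)
Definition good (n : nat) (s : binseq) : Prop :=
  orientable n s /\ occurs_once (nseq (n - 4) false) s.

Definition lempel (t : binseq) : binseq := fun i => t i (+) t i.+1.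

Definition lempel_preim (s : binseq) : set binseq :=
  [set t | periodic t /\ lempel t = s]%classic.

Definition of_cycle (c : seq bool) : binseq :=
  fun i => nth false c (i %% size c).

Definition extension_domain (k : nat) (u : binseq) : Prop :=
  orientable k u /\ occurs_once (nseq (k - 4) true) u.

(* On the domain above, the position r < period u of the unique run 1^{k-4}. *)
Definition run_pos (k : nat) (u : binseq) : nat :=
  find (fun r => window u (k - 4) r == nseq (k - 4) true) (iota 0 (period u)).

(* The run starting at r may wrap around the end of the generating cycle; the
   insertion at r still lengthens it by one, and the result differs only by a
   rotation from the one obtained from a cycle in which the run does not wrap.
   The value is meaningful only on extension_domain k. *)
Definition extension (k : nat) (u : binseq) : binseq :=
  if odd (weight u) then u
  else let c := generating_cycle u in
       let r := run_pos k u in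
       of_cycle (take r c ++ true :: drop r c).

(* Main.v *)
(* Odd weight makes T(i + m) the complement of T(i), so T has period 2m and
   weight m, and it inherits orientability from S through the Lempel map. With
   k = n - 3, the windows of T constant of length k lie over the occurrences of
   0^(k-1) in S, so 0^k and 1^k each occur once. When m is even, lengthening
   1^k by one produces a sequence whose windows of length k + 4 either are
   windows of T or contain 1^(k+1) at one of four offsets. The latter are told
   apart by the zeros bounding the run, up to reversal; two of them could only
   be reverses of each other if the letters c, d in c 0 1^k 0 d agreed, but this
   word is a window of T and hence not a palindrome. *)

Require Import Defs.
From mathcomp Require Import all_boot.
From mathcomp Require Import boolp classical_sets.
From mathcomp Require Import zify.

Set Implicit Arguments.
Unset Strict Implicit.
Unset Printing Implicit Defensive.

(** * Periods, windows and cyclic occurrences *)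

Lemma is_period_uniq (s : binseq) (p q : nat) :
  is_period s p -> is_period s q -> p = q.
Proof.
move=> [p0 rp minp] [q0 rq minq]; apply/eqP; rewrite eqn_leq.
by rewrite minp // minq.
Qed.

Lemma periodE (s : binseq) (p : nat) : is_period s p -> period s = p.
Proof.
move=> sp; apply: (is_period_uniq (s := s)) => //.
exact: (@xgetPex _ 0 [set m | is_period s m]%classic (ex_intro _ p sp)).
Qed.

Lemma repeatsM (s : binseq) (p c i : nat) : repeats s p -> s (i + c * p) = s i.
Proof.
move=> rp; elim: c => [|c IH]; first by rewrite addn0.
by rewrite mulSn [p + _]addnC addnA rp.
Qed.

Lemma repeats_mod (s : binseq) (p i j : nat) :
  repeats s p -> i = j %[mod p] -> s i = s j.
Proof.
move=> rp eij; rewrite (divn_eq i p) (divn_eq j p) eij.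
by rewrite ![_ * p + _]addnC !repeatsM.
Qed.

Lemma eq_windowP (s t : binseq) (k i j : nat) :
  window s k i = window t k j <-> (forall x, x < k -> s (i + x) = t (j + x)).
Proof.
split=> [e x xk | e]; last by apply/eq_in_map => x; rewrite mem_iota; apply: e.
by have := congr1 (nth false ^~ x) e; rewrite !nth_mkseq.
Qed.

Lemma window_nseqP (s : binseq) (k i : nat) (b : bool) :
  window s k i = nseq k b <-> (forall x, x < k -> s (i + x) = b).
Proof.
have -> : nseq k b = window (fun=> b) k 0.
  apply: (@eq_from_nth _ false) => [|x]; rewrite size_nseq ?size_mkseq // => xk.
  by rewrite nth_nseq xk nth_mkseq.
exact: eq_windowP.
Qed.

Lemma eq_window_revP (s t : binseq) (k i j : nat) :
  window s k i = rev (window t k j) <->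
  (forall x, x < k -> s (i + x) = t (j + (k - x.+1))).
Proof.
have E x : x < k -> nth false (rev (window t k j)) x = t (j + (k - x.+1)).
  by move=> xk; rewrite nth_rev size_mkseq // nth_mkseq //; lia.
split=> [e x xk | e].
  by rewrite -E // -e nth_mkseq.
apply: (@eq_from_nth _ false) => [|x]; rewrite ?size_rev ?size_mkseq // => xk.
by rewrite E // nth_mkseq // e.
Qed.

Lemma window_mod (s : binseq) (p k i j : nat) :
  repeats s p -> i = j %[mod p] -> window s k i = window s k j.
Proof.
move=> rp eij; apply/eq_windowP => x _; apply: (repeats_mod rp).
by rewrite -modnDml eij modnDml.
Qed.

Lemma occurs_onceP (v : seq bool) (s : binseq) (p : nat) : is_period s p ->
  occurs_once v s <->
  exists i0, forall i, (window s (size v) i == v) = (i == i0 %[mod p]).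
Proof.
move=> sp; have [p0 rp _] := sp; rewrite /occurs_once (periodE sp); split.
  move/eqP/cards1P => [i0 e]; exists i0 => i.
  rewrite (window_mod _ rp (esym (modn_mod i p))).
  have := congr1 (fun A : {set 'I_p} => Ordinal (ltn_pmod i p0) \in A) e.
  by rewrite !inE -val_eqE /= (modn_small (ltn_ord i0)).
move=> [i0 e]; apply/eqP/cards1P; exists (Ordinal (ltn_pmod i0 p0)).
apply/setP=> i; rewrite !inE -val_eqE /= e.
by rewrite (modn_small (ltn_ord i)).
Qed.

(** If [s] also repeats with [q], its windows at 0 and at [q] agree, so injectivity makes [p] divide
    [q]. *)
Lemma is_period_of_window (s : binseq) (n p : nat) : 0 < p -> repeats s p ->
  (forall i j, window s n i = window s n j -> i = j %[mod p]) ->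
  is_period s p.
Proof.
move=> p0 rp inj; split=> // q q0 rq; apply: dvdn_leq => //.
rewrite /dvdn -(mod0n p); apply/eqP/inj/eq_windowP => x _.
by rewrite addnC add0n rq.
Qed.

(** * Sequences that a shift by [m] complements *)

Section LempelPreimage.

Variables (T : binseq) (m : nat).
Hypothesis T_compl : forall i, T (i + m) = ~~ T i.

Lemma compl_mul (i c : nat) : T (i + c * m) = T i (+) odd c.
Proof.
elim: c => [|c IH]; first by rewrite addn0 addbF.
by rewrite mulSn [m + _]addnC addnA T_compl IH /= addbN.
Qed.

Lemma compl_repeats : repeats T (2 * m).
Proof. by move=> i; rewrite compl_mul addbF. Qed.

(** If [j = i + c * m], the two values differ by the parity of [c]; equal values force [c] to be
    even. *)
Lemma compl_mod (i j : nat) :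
  i = j %[mod m] -> T i = T j -> i = j %[mod (2 * m)].
Proof.
wlog le_ij : i j / i <= j => [W e t | /eqP e t].
  by case/orP: (leq_total i j) => le; [|apply/esym]; apply: W.
move: e; rewrite eq_sym eqn_mod_dvd // => /dvdnP[c ej].
have ej' : j = i + c * m by lia.
move: t; rewrite ej' compl_mul; case oc: (odd c); first by case: (T i).
by move=> _; rewrite -(odd_double_half c) oc add0n -muln2 -mulnA addnC modnMDl.
Qed.

(** Each pair of positions [i] and [i + m] contributes exactly one. *)
Lemma compl_sum : \sum_(i < 2 * m) T i = m.
Proof.
rewrite mul2n -addnn big_split_ord /= -big_split /=.
rewrite -[RHS]muln1 -[in RHS](card_ord m).
rewrite -sum_nat_const; apply: eq_bigr => i _.
by rewrite [m + _]addnC T_compl; case: (T i).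
Qed.

End LempelPreimage.

(** Modulo 2 the sum of [lempel T] telescopes to [T 0 (+) T m], which settles [i = 0]; repetition of
    [lempel T] carries the relation forward. *)
Lemma lempel_compl (T : binseq) (m : nat) :
  repeats (lempel T) m -> odd (\sum_(i < m) lempel T i) ->
  forall i, T (i + m) = ~~ T i.
Proof.
move=> rm om; have sumE c : odd (\sum_(i < c) lempel T i) = T 0 (+) T c.
  elim: c => [|c IH]; first by rewrite big_ord0 addbb.
  by rewrite big_ord_recr /= oddD IH oddb /lempel addbA addbK.
elim=> [|i IH].
  by move: om; rewrite sumE add0n; case: (T 0); case: (T m).
have step j : T j.+1 = T j (+) lempel T j by rewrite /lempel addbA addbb.
by rewrite addSn !step IH rm addNb.
Qed.

(** * Lengthening the unique run of ones *)

Section Extension.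

(* In this section [U] is [T] with the unique run [1^k], which starts at [r],
   lengthened by one. *)
Variables (T U : binseq) (p k r : nat).
Hypotheses (p_gt3 : 3 < p) (k_gt1 : 1 < k).
Hypothesis T_repeats : repeats T p.
Hypothesis T_inj :
  forall i j, window T (k + 4) i = window T (k + 4) j -> i = j %[mod p].
Hypothesis T_asym :
  forall i j, window T (k + 4) i <> rev (window T (k + 4) j).
Hypothesis T_ones :
  forall i, (window T k i == nseq k true) = (i == r %[mod p]).
Hypothesis U_repeats : repeats U p.+1.
Hypothesis U_run : U r = true.
Hypothesis U_shift : forall x, x < p -> U (r + x.+1) = T (r + x).

Lemma T_run (x : nat) : x < k -> T (r + x) = true.
Proof.
by apply: (window_nseqP T k r true).1; apply/eqP; rewrite T_ones.
Qed.

(** A run filling a whole period would make [T] constantly 1, so that [1^k] would also start at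
    [r.+1]. *)
Lemma run_lt_period : k < p.
Proof.
rewrite ltnNge; apply/negP => pk.
have : window T k r.+1 == nseq k true.
  apply/eqP/window_nseqP => x _; rewrite addSnnS.
  rewrite (repeats_mod T_repeats (esym (modnDmr r x.+1 p))) T_run //.
  by apply: leq_trans pk; rewrite ltn_pmod //; lia.
rewrite T_ones eqn_mod_dvd; last by lia.
by rewrite subSnn dvdn1; lia.
Qed.

(** For another [k] letters after [x = p], both sides lie inside their runs of ones, so the shift by
    one persists. *)
Lemma U_shift_run (x : nat) : x < p + k -> U (r + x.+1) = T (r + x).
Proof.
move=> xpk; case: (ltnP x p) => [/U_shift // | px].
have -> : r + x.+1 = r + (x - p) + p.+1 by lia.
rewrite U_repeats.
have -> : T (r + x) = true.
  have -> : r + x = r + (x - p) + p by lia.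
  by rewrite T_repeats T_run //; lia.
case E: (x - p) => [|y]; first by rewrite addn0.
by have kp := run_lt_period; rewrite U_shift ?T_run //; lia.
Qed.

Lemma window_shift (l x : nat) : x + l <= p + k ->
  window U l (r + x.+1) = window T l (r + x).
Proof.
move=> le; apply/eq_windowP => y yl.
by rewrite -!addnA addSn U_shift_run //; lia.
Qed.

Lemma U_reindex (i : nat) : exists2 x, x <= p & i = r + x.+1 %[mod p.+1].
Proof.
(* Since [p] is -1 modulo [p.+1], the witness is [i - r.+1]. *)
exists ((i + r.+1 * p) %% p.+1); first by rewrite -ltnS ltn_pmod.
rewrite addnS -addSn modnDmr addnA [r.+1 + i]addnC -addnA -mulnS.
by rewrite addnC modnMDl.
Qed.

(** A one here would let [1^k] start one position before [r] as well. *)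
Lemma T_pred : T (r + p.-1) = false.
Proof.
apply/negbTE/negP => t.
have : window T k (r + p.-1) == nseq k true.
  apply/eqP/window_nseqP => -[|x] xk; first by rewrite addn0.
  have -> : r + p.-1 + x.+1 = r + x + p by lia.
  by rewrite T_repeats T_run //; lia.
rewrite T_ones -(modnDr r p) eq_sym eqn_mod_dvd; last by lia.
have -> : r + p - (r + p.-1) = 1 by lia.
by rewrite dvdn1; lia.
Qed.

Lemma T_next : T (r + k) = false.
Proof.
apply/negbTE/negP => t.
have : window T k r.+1 == nseq k true.
  apply/eqP/window_nseqP => x xk; rewrite addSnnS.
  have [->//|xk'] := eqVneq x.+1 k.
  by rewrite T_run //; lia.
rewrite T_ones eqn_mod_dvd; last by lia.
by rewrite subSnn dvdn1; lia.
Qed.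

(* [c 0 1^k 0 d] is a window of [T] of length [k + 4], so not a palindrome. *)
Lemma T_sides : T (r + p - 2) <> T (r + k.+1).
Proof.
move=> e; apply: (T_asym (i := r + p - 2) (j := r + p - 2)).
have ones x : x < k -> T (r + p - 2 + x.+2) = true.
  move=> xk; have -> : r + p - 2 + x.+2 = r + x + p by lia.
  by rewrite T_repeats T_run.
have e1 : T (r + p - 2 + 1) = false by rewrite -T_pred; congr T; lia.
have e2 : T (r + p - 2 + k.+2) = false.
  by rewrite -T_next -(T_repeats (r + k)); congr T; lia.
have e3 : T (r + p - 2 + k.+3) = T (r + p - 2).
  by rewrite e -(T_repeats (r + k.+1)); congr T; lia.
apply/eq_window_revP => -[|[|x]] xk.
- by rewrite addn0 -e3; congr T; lia.
- by rewrite e1 -[LHS]e2; congr T; lia.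
have [xk'|xk'] := ltnP x k.
  by rewrite ones // -(ones (k.-1 - x)); [congr T; lia | lia].
have [->|->] : x = k \/ x = k.+1 by lia.
  by rewrite e2 -[LHS]e1; congr T; lia.
by rewrite e3; congr T; lia.
Qed.

(* The four windows of [U] containing [1^(k+1)] are those starting at
   [r - a] for [a < 4]. *)
Definition special (a : nat) := r + (p - a).+1.

Lemma special_run (a x : nat) : a < 4 -> a <= x <= a + k ->
  U (special a + x) = true.
Proof.
move=> a4 xa; have -> : special a + x = r + (x - a) + p.+1.
  by rewrite /special; lia.
rewrite U_repeats; case E: (x - a) => [|y]; first by rewrite addn0.
by rewrite U_shift_run ?T_run //; lia.
Qed.

Lemma special_prev (a : nat) : 0 < a < 4 -> U (special a + a.-1) = false.
Proof.
move=> a4; rewrite -T_pred -U_shift_run; last by lia.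
by congr U; rewrite /special; lia.
Qed.

Lemma special_next (a : nat) : a < 4 -> U (special a + (a + k.+1)) = false.
Proof.
move=> a4; rewrite -T_next -U_shift_run -1?(U_repeats (r + k.+1)); last by lia.
by congr U; rewrite /special; lia.
Qed.

Lemma special_prev2 (a : nat) : 1 < a < 4 ->
  U (special a + (a - 2)) = T (r + p - 2).
Proof.
move=> a4; have -> : r + p - 2 = r + (p - 2) by lia.
by rewrite -U_shift_run; [congr U; rewrite /special|]; lia.
Qed.

Lemma special_next2 (a : nat) : a < 4 ->
  U (special a + (a + k.+2)) = T (r + k.+1).
Proof.
move=> a4; rewrite -U_shift_run -1?(U_repeats (r + k.+2)); last by lia.
by congr U; rewrite /special; lia.
Qed.

(** The bound [x + 4 <= p] is what [window_shift] needs at length [k + 4]; the remaining offsets are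
    [p - a] with [a < 4]. *)
Lemma U_window_cases (i : nat) :
  (exists2 x, x + 4 <= p & i = r + x.+1 %[mod p.+1]) \/
  (exists2 a, a < 4 & i = special a %[mod p.+1]).
Proof.
have [x xp e] := U_reindex i; have [le|lt] := leqP (x + 4) p.
  by left; exists x.
right; exists (p - x); first by lia.
by rewrite e /special; congr (_ %% _); lia.
Qed.

(** A run [1^(k+1)] would contain [1^k] at two consecutive positions, which are distinct modulo
    [p]. *)
Lemma T_no_longer_run (i x : nat) :
  ~ (forall y, x <= y <= x + k -> T (i + y) = true).
Proof.
move=> t; have run j : j <= 1 -> i + x + j == r %[mod p].
  move=> j1; rewrite -T_ones; apply/eqP/window_nseqP => y yk.
  by rewrite -!addnA t //; lia.
have := run 1 isT; rewrite -(eqP (run 0 isT)) addn0 eqn_mod_dvd; last by lia.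
by rewrite addKn dvdn1; lia.
Qed.

Lemma plain_special_neq (x a : nat) : x + 4 <= p -> a < 4 ->
  window U (k + 4) (r + x.+1) <> window U (k + 4) (special a).
Proof.
move=> xp a4; rewrite window_shift; last by lia.
move/eq_windowP => e; apply: (@T_no_longer_run (r + x) a) => y ya.
by rewrite e ?special_run //; lia.
Qed.

Lemma plain_special_neq_rev (x a : nat) : x + 4 <= p -> a < 4 ->
  window U (k + 4) (r + x.+1) <> rev (window U (k + 4) (special a)).
Proof.
move=> xp a4; rewrite window_shift; last by lia.
(* Reversing a window of length [k + 4] moves [1^(k+1)] from offset [a] to offset [3 - a]. *)
move/eq_window_revP => e; apply: (@T_no_longer_run (r + x) (3 - a)) => y ya.
by rewrite e ?special_run //; lia.
Qed.

Lemma special_inj (a b : nat) : a < 4 -> b < 4 ->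
  window U (k + 4) (special a) = window U (k + 4) (special b) -> a = b.
Proof.
wlog ab : a b / a <= b => [W a4 b4 e | a4 b4 /eq_windowP e].
  by case/orP: (leq_total a b) => ab; [|apply/esym]; apply: W.
apply/eqP; rewrite eqn_leq ab /= leqNgt; apply/negP => ltab.
(* At offset [b.-1] the first window is still in its run, while the second has the zero preceding
   its run. *)
by have := e b.-1; rewrite special_run ?special_prev; lia.
Qed.

(** Reversal moves the run of [special b] to offset [3 - b]. If this differs from [a], a zero
    bounding one run meets a one of the other. Otherwise the letters beyond the bounding zeros meet,
    against [T_sides]. *)
Lemma special_asym (a b : nat) : a < 4 -> b < 4 ->
  window U (k + 4) (special a) <> rev (window U (k + 4) (special b)).
Proof.
move=> a4 b4 /eq_window_revP e.
have [lt|] := ltnP (a + b) 3.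
  have := e (2 - b) ltac:(lia); rewrite special_run; try lia.
  have -> : k + 4 - (2 - b).+1 = b + k.+1 by lia.
  by rewrite special_next.
rewrite leq_eqVlt => /orP[/eqP eab|gt].
  (* As [a + b = 3], one of the two is at least 2, and its window shows the letter before the zero
     preceding the run. *)
  have [a2|a2] := leqP 2 a.
    apply: T_sides; rewrite -(@special_prev2 a) ?e -?(@special_next2 b); try lia.
    by congr U; lia.
  apply: T_sides; rewrite -(@special_prev2 b) -?(@special_next2 a) ?e; try lia.
  by congr U; lia.
have := e a.-1 ltac:(lia); rewrite special_prev ?special_run //; lia.
Qed.

Lemma extension_inj (i j : nat) :
  window U (k + 4) i = window U (k + 4) j -> i = j %[mod p.+1].
Proof.
have [[x xp ei]|[a a4 ei]] := U_window_cases i;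
have [[y yp ej]|[b b4 ej]] := U_window_cases j;
rewrite (window_mod _ U_repeats ei) (window_mod _ U_repeats ej) ei ej.
- rewrite !window_shift; try lia.
  move/T_inj/eqP; rewrite eqn_modDl (@modn_small x) ?(@modn_small y); try lia.
  by move/eqP=> ->.
- by move/plain_special_neq => /(_ xp b4).
- by move/esym/plain_special_neq => /(_ yp a4).
- by move/special_inj => ->.
Qed.

Lemma extension_asym (i j : nat) :
  window U (k + 4) i <> rev (window U (k + 4) j).
Proof.
have [[x xp ei]|[a a4 ei]] := U_window_cases i;
have [[y yp ej]|[b b4 ej]] := U_window_cases j;
rewrite (window_mod _ U_repeats ei) (window_mod _ U_repeats ej).
- by rewrite !window_shift; try lia; apply: T_asym.
- exact: plain_special_neq_rev.
- by move/(congr1 rev); rewrite revK => /esym; apply: plain_special_neq_rev.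
- exact: special_asym.
Qed.

(** The window of [U] at [r] starts with a one; every other window of length [k] is a shifted window
    of [T]. *)
Lemma extension_zeros (z : nat) :
  (forall i, (window T k i == nseq k false) = (i == z %[mod p])) ->
  exists z', forall i, (window U k i == nseq k false) = (i == z' %[mod p.+1]).
Proof.
move=> Tz; have p0 : 0 < p by lia.
(* This is [z - r] modulo [p], as [p.-1] is -1. *)
pose x0 := (z + r * p.-1) %% p.
have x0p : x0 < p by rewrite ltn_pmod.
have ez : r + x0 = z %[mod p].
  rewrite modnDmr addnCA -mulnS prednK // addnC modnMDl //.
exists (r + x0.+1) => i; have [x xp e] := U_reindex i.
rewrite (window_mod _ U_repeats e) e eqn_modDl.
have [->|xp'] := eqVneq x p.
  rewrite modnn modn_small //; apply/negbTE/negP.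
  move/eqP/window_nseqP => /(_ 0 ltac:(lia)); rewrite addn0.
  by rewrite U_repeats U_run.
rewrite window_shift; last by lia.
rewrite Tz -ez eqn_modDl (@modn_small x) ?(@modn_small x0) ?(@modn_small x.+1);
  try lia.
by rewrite modn_small ?eqSS; lia.
Qed.

End Extension.

(** * Inserting a one into a generating cycle *)

Definition insert_true (c : seq bool) (r : nat) : seq bool :=
  take r c ++ true :: drop r c.

Lemma size_insert_true (c : seq bool) (r : nat) :
  size (insert_true c r) = (size c).+1.
Proof. by rewrite size_cat /= addnS -size_cat cat_take_drop. Qed.

Lemma of_cycle_repeats (c : seq bool) : repeats (of_cycle c) (size c).
Proof. by move=> i; rewrite /of_cycle modnDr. Qed.

Lemma of_cycle_insert_true (c : seq bool) (r : nat) : r < size c ->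
  of_cycle (insert_true c r) r = true.
Proof.
move=> rc; rewrite /of_cycle size_insert_true modn_small; last by lia.
by rewrite nth_cat size_take rc ltnn subnn.
Qed.

Lemma of_cycle_insert_true_shift (s : binseq) (p r x : nat) :
  repeats s p -> r < p -> x < p ->
  of_cycle (insert_true (mkseq s p) r) (r + x.+1) = s (r + x).
Proof.
move=> rs rp xp; rewrite /of_cycle size_insert_true size_mkseq.
rewrite nth_cat size_take size_mkseq rp.
have [lt|ge] := ltnP (r + x) p.
  rewrite modn_small; last by lia.
  rewrite ltnNge leq_addr /= addKn /= nth_drop nth_mkseq //.
(* Past the end of the cycle the index wraps to the part before the inserted letter, where no shift
   occurs. *)
have -> : r + x.+1 = r + x - p + p.+1 by lia.
rewrite modnDr modn_small; last by lia.
have -> : r + x - p < r by lia.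
rewrite nth_take ?nth_mkseq; try lia.
by rewrite -rs subnK.
Qed.

Lemma of_cycle_sum (c : seq bool) :
  \sum_(i < size c) of_cycle c i = \sum_(b <- c) b.
Proof.
rewrite (big_nth false) big_mkord; apply: eq_bigr => i _.
by rewrite /of_cycle modn_small.
Qed.

Lemma insert_true_sum (c : seq bool) (r : nat) :
  \sum_(b <- insert_true c r) b = (\sum_(b <- c) b).+1.
Proof.
rewrite -[in RHS](cat_take_drop r c) !big_cat big_cons /=.
by rewrite addnCA add1n.
Qed.

Lemma run_posP (k p r : nat) (u : binseq) : is_period u p ->
  (forall i, (window u (k - 4) i == nseq (k - 4) true) = (i == r %[mod p])) ->
  run_pos k u < p /\ run_pos k u = r %[mod p].
Proof.
move=> up ur; have [p0 rp _] := up.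
pose a i := window u (k - 4) i == nseq (k - 4) true.
have ha : has a (iota 0 p).
  apply/hasP; exists (r %% p); first by rewrite mem_iota ltn_pmod.
  by rewrite /a ur modn_mod.
rewrite /run_pos (periodE up); have lt := ha; rewrite has_find size_iota in lt.
split=> //; have := nth_find 0 ha; rewrite nth_iota // add0n /a ur.
by move/eqP.
Qed.

(** * Lifting from [S] to [T], then the two parities of [m] *)

Theorem theorem5 (n m : nat) (S : binseq) :
  good n S -> odd (weight S) -> is_period S m ->
  forall T : binseq, lempel_preim S T ->
    extension_domain n.+1 T /\
    [/\ good n.+1 (extension n.+1 T),
        odd (weight (extension n.+1 T))
      & is_period (extension n.+1 T) (if odd m then 2 * m else (2 * m).+1)].
Proof.
move=> [[_ injS asymS] onceS] oddS Sm T [_ eTS].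
have [m0 rS _] := Sm.
move: injS oddS onceS; rewrite /weight (periodE Sm) => injS oddS.
move/(occurs_onceP _ Sm); rewrite size_nseq => -[z zS].
have [q en] : exists q, n = q.+1 + 4.
  exists (n - 5); suff : 4 < n by lia.
  rewrite ltnNge; apply/negP => n4.
  (* For [n <= 4] the empty word occurs at both [z] and [z.+1], so [m = 1] and [S] is constant,
     hence equal to its reverse. *)
  have := zS z.+1; have -> : n - 4 = 0 by lia.
  rewrite [window _ _ _]/= eqxx eqn_mod_dvd // subSnn dvdn1 => /esym/eqP m1.
  apply: (asymS 0 0); apply/eq_window_revP => x _.
  by apply: (repeats_mod rS); rewrite m1 !modn1.
subst n; rewrite addnK in zS.
have T_compl : forall i, T (i + m) = ~~ T i by apply: lempel_compl; rewrite eTS.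
have p0 : 0 < 2 * m by lia.
have rT := compl_repeats T_compl.
have TS l i j : window T l.+1 i = window T l.+1 j -> window S l i = window S l j.
  move/eq_windowP => e; apply/eq_windowP => x xl; rewrite -eTS /lempel -!addnS.
  by rewrite !e //; lia.
have injT i j : window T (q.+2 + 4) i = window T (q.+2 + 4) j ->
    i = j %[mod 2 * m].
  move=> e; apply: (compl_mod T_compl); first exact/injS/TS.
  by move/eq_windowP/(_ 0 isT): e; rewrite !addn0.
have asymT i j : window T (q.+2 + 4) i <> rev (window T (q.+2 + 4) j).
  move/eq_window_revP => e; apply: (asymS i j); apply/eq_window_revP => x xl.
  rewrite -eTS /lempel -addnS !e; try lia.
  (* Reversal swaps the two summands of each letter of [S], and their sum is symmetric. *)
  by rewrite addbC; congr (T _ (+) T _); lia.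
have Tm : is_period T (2 * m) by apply: is_period_of_window injT.
have runs b : exists r, forall i,
    (window T q.+2 i == nseq q.+2 b) = (i == r %[mod 2 * m]).
  (* The positions [z] and [z + m] both lie over [z] and carry complementary letters; one of them
     starts the run of [b]. *)
  have [r rz Tr] : exists2 r, r = z %[mod m] & T r = b.
    have [<-|/eqP Tz] := eqVneq (T z) b; first by exists z.
    exists (z + m); first by rewrite modnDr.
    by rewrite T_compl; case: (T z) b Tz => -[].
  exists r => i; apply/eqP/eqP => [w|e].
    have bT := (window_nseqP T q.+2 i b).1 w.
    apply: (compl_mod T_compl); last by rewrite Tr -(bT 0) ?addn0.
    rewrite rz; apply/eqP; rewrite -zS; apply/eqP/window_nseqP => x xq.
    by rewrite -eTS /lempel -addnS !bT ?addbb //; lia.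
  rewrite (window_mod _ rT e); apply/window_nseqP.
  have S0 x : x < q.+1 -> S (r + x) = false.
    by apply: (window_nseqP _ _ _ _).1; apply/eqP; rewrite zS rz.
  (* A zero of [S] means that [T] does not change, so the value [b] at [r] propagates. *)
  elim=> [|x IH] xq; first by rewrite addn0.
  have := S0 x ltac:(lia); rewrite -eTS /lempel -addnS IH; last by lia.
  by case: (b); case: (T _).
have [r1 ones] := runs true; have [r0 zeros] := runs false.
have k4 : (q.+1 + 4).+1 - 4 = q.+2 by lia.
have oT : orientable (q.+1 + 4).+1 T.
  by split; [exists (2 * m) | rewrite (periodE Tm) | ].
split.
  split=> //; apply/(occurs_onceP _ Tm); rewrite size_nseq k4; by exists r1.
rewrite /extension /weight (periodE Tm) (compl_sum T_compl).
case: ifPn => [om | em].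
  rewrite (periodE Tm) (compl_sum T_compl); split=> //; split=> //.
  apply/(occurs_onceP _ Tm); rewrite size_nseq k4; by exists r0.
have [rp er] := run_posP Tm (k := (q.+1 + 4).+1) (r := r1) ltac:(by rewrite k4).
rewrite /generating_cycle (periodE Tm).
move: (run_pos _ _) rp er => r rp er; rewrite -/(insert_true _ _).
set c := mkseq T (2 * m); set U := of_cycle _.
have sc : size (insert_true c r) = (2 * m).+1.
  by rewrite size_insert_true size_mkseq.
have rU : repeats U (2 * m).+1 by rewrite -sc; apply: of_cycle_repeats.
(* Here [m] is even and positive, so at least 2. *)
have p3 : 3 < 2 * m by lia.
have ones' i : (window T q.+2 i == nseq q.+2 true) = (i == r %[mod 2 * m]).
  by rewrite ones er.
have Ur : U r = true by apply: of_cycle_insert_true; rewrite size_mkseq.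
have Ux x : x < 2 * m -> U (r + x.+1) = T (r + x).
  exact: of_cycle_insert_true_shift.
have k1 : 1 < q.+2 by [].
have injU := extension_inj p3 k1 rT injT ones' rU Ur Ux.
have asymU := extension_asym p3 k1 rT asymT ones' rU Ur Ux.
have [z' zU] := extension_zeros p3 k1 rT ones' rU Ur Ux zeros.
have Um : is_period U (2 * m).+1 by apply: is_period_of_window injU.
split=> //.
  split; first by split; [exists (2 * m).+1 | rewrite (periodE Um) | ].
  apply/(occurs_onceP _ Um); rewrite size_nseq k4; by exists z'.
(* The weight is that of [T] plus the inserted one, [m + 1], with [m] even. *)
rewrite (periodE Um) -sc of_cycle_sum insert_true_sum /=.
have -> : \sum_(b <- c) b = m 
  by rewrite big_map -{1}[2 * m]subn0 big_mkord (compl_sum T_compl).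
exact: em.
Qed.
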